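(* Let $\mathbf{g}$ be a generalized Golay--Shapiro sequence. Then (a) for all $n \geq 15$, $r_{\mathbf{g}}(n) = \rho_{\mathbf{g}} (n) = 8n-8$; and (b) the reflection complexity is the same for every generalized Golay--Shapiro sequence, with $(r_{\mathbf{g}}(n))_{1\le n\le 14} = 2, 3, 6, 10, 14, 22, 30, 42, 48, 62, 72, 83, 92, 103$.
   Context: Let $E$ be the morphism on $\{0,1\}^*$ exchanging $0$ and $1$, and for $u=u(1)\cdots u(m)$ let $u^R=u(m)\cdots u(1)$. Given an infinite sequence $\mathbf{f}=f_0f_1\cdots$ of binary unfolding instructions, define $p_{\varepsilon}=\varepsilon$ and $p_{f_0\cdots f_{i+1}} = p_{f_0\cdots f_i}\, f_{i+1}\, E(p_{f_0\cdots f_i}^R)$; the limit is the paperfolding sequence $\mathbf{p}_{\mathbf{f}}$. A generalized Golay--Shapiro sequence is the running sum, modulo $2$, of a paperfolding sequence $\mathbf{p}_{\mathbf{f}}$. A factor is a finite contiguous block. $\rho_{\mathbf{g}}(n)$ is the number of distinct length-$n$ factors; $r_{\mathbf{g}}(n)$ the number of distinct length-$n$ factors up to $u\sim v\iff v\in\{u,u^R\}$. *)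

(* Defs.v *)
From mathcomp Require Import all_boot.
From mathcomp Require Import boolp.

Set Implicit Arguments.
Unset Strict Implicit.
Unset Printing Implicit Defensive.

(* The letters 0 and 1 are [false] and [true]. *)

Definition exchange (u : seq bool) : seq bool := map negb u.

(* [fold_word f k] is p_{f_0 ... f_(k-1)}. *)
Fixpoint fold_word (f : nat -> bool) (k : nat) : seq bool :=
  if k is k'.+1 then
    fold_word f k' ++ f k' :: exchange (rev (fold_word f k'))
  else [::].

(* The limit of the words [fold_word f k], its letters being numbered from 0.
   [fold_word f n.+1] has length 2 ^ n.+1 - 1 > n, so that the default value
   of [nth] is never used; see [fold_word_prefix]. *)
Definition paperfolding (f : nat -> bool) (n : nat) : bool :=
  nth false (fold_word f n.+1) n.

Lemma size_fold_word f k : size (fold_word f k) = (2 ^ k).-1.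
Proof.
elim: k => //= k IHk.
rewrite size_cat /= size_map size_rev IHk expnS mul2n -addnn.
by have := expn_gt0 2 k; case: (2 ^ k) => // m _; rewrite addSn.
Qed.

Lemma fold_word_prefix f k : fold_word f k = mkseq (paperfolding f) (2 ^ k).-1.
Proof.
have stable a b i : a <= b -> i < (2 ^ a).-1 ->
    nth false (fold_word f b) i = nth false (fold_word f a) i.
  move=> le_ab lt_i; rewrite -(subnKC le_ab); elim: (b - a) => [|d IHd].
    by rewrite addn0.
  rewrite addnS /= nth_cat size_fold_word (leq_trans lt_i) ?IHd //.
  by rewrite -!subn1 leq_sub2r // leq_exp2l // leq_addr.
apply: (@eq_from_nth _ false); first by rewrite size_mkseq size_fold_word.
move=> i; rewrite size_fold_word => lt_i; rewrite nth_mkseq // /paperfolding.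
have lt_i2 : i < (2 ^ i.+1).-1.
  by have := ltn_expl i.+1 (isT : 1 < 2); case: (2 ^ i.+1).
by case: (leqP k i.+1) => [|/ltnW] h; [rewrite (stable _ _ _ h lt_i)
                                      | rewrite (stable _ _ _ h lt_i2)].
Qed.

(* The sum modulo 2 of the first [n] terms of [p]. *)
Definition sum_mod2 (p : nat -> bool) (n : nat) : bool :=
  odd (\sum_(i < n) p i).

(* A running sum may or may not begin with the empty sum, and both conventions
   are admitted: the usual Golay--Shapiro sequence 0001001000011101... begins
   with the empty sum, while the sequence of sums p_0, p_0 + p_1, ... does
   not. *)
Definition is_generalized_golay_shapiro (g : nat -> bool) : Prop :=
  exists f : nat -> bool,
    (forall n, g n = sum_mod2 (paperfolding f) n) \/
    (forall n, g n = sum_mod2 (paperfolding f) n.+1).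

Definition factors (g : nat -> bool) (n : nat) : {set n.-tuple bool} :=
  [set u : n.-tuple bool | `[< exists i, u = [tuple g (i + j) | j < n] >]].

Definition refl_equiv (n : nat) : rel (n.-tuple bool) :=
  fun u v => (v == u) || (v == [tuple of rev u]).

Definition factor_complexity (g : nat -> bool) (n : nat) : nat :=
  #|factors g n|.

Definition refl_complexity (g : nat -> bool) (n : nat) : nat :=
  #|equivalence_partition (@refl_equiv n) (factors g n)|.

(* Main.v *)
(* The letters of a paperfolding sequence at the odd multiples of 2 ^ v (counting
   positions from 1) alternate, for every v; erasing those with v >= j leaves a
   sequence of period 2 ^ j.+1 whose holes are the multiples of 2 ^ j. For
   2 ^ j <= m <= 2 ^ j.+1, a window of m letters is therefore given by its
   starting point modulo 2 ^ j.+1 and by the letters in its one or two holes.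
   All these data are realized, and they can be read off the window when
   m >= 7, so that there are 4 * m windows. Every window moreover recurs after
   prefixes of both parities, which gives 2 * (4 * m) factors of length m.+1 in
   the running sums. If such a factor and its reversal both occurred, a window
   of the paperfolding sequence would be the mirror image of another one, but
   the orientation of the alternations modulo 8 excludes this for 14 letters.
   For shorter factors the codes with j = 3 depend on three folding
   instructions only, and the eight cases are computed. *)
Require Import Defs.
From mathcomp Require Import all_boot all_order.
From mathcomp Require Import boolp zify.

Set Implicit Arguments.
Unset Strict Implicit.
Unset Printing Implicit Defensive.

(** * Alternating levels and holes *)

(* The alternations [nth false F v] of the levels [v < size F]; the holes, at
   the multiples of [2 ^ size F], are filled with the letters of [z]. Positions
   are numbered from 1. *)
Fixpoint letter (F : seq bool) (z : nat -> bool) (m : nat) : bool :=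
  if F is a :: F' then
    if odd m then a (+) odd m./2 else letter F' z m./2
  else z m.

Lemma half_eqmod m m' d : m = m' %[mod 2 * d] ->
  odd m = odd m' /\ m./2 = m'./2 %[mod d].
Proof.
move=> e; split.
  have ev : odd (2 * d) = false by lia.
  by rewrite -(odd_mod m ev) -(odd_mod m' ev) e.
by rewrite -!divn2 !modn_divl mulnC e.
Qed.

(** A position off the holes is an odd multiple of [2 ^ v] with [v < size F], and its letter depends
    on it modulo [2 ^ v.+2] only. *)
Lemma letter_eqmod F z z' m m' : m = m' %[mod 2 ^ (size F).+1] ->
  ~~ (2 ^ size F %| m) -> letter F z m = letter F z' m'.
Proof.
elim: F m m' => [|a F IH] m m' /=; first by rewrite expn0 dvd1n.
rewrite expnS => /half_eqmod[eo eh] ndv; rewrite -eo.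
have [om|em] := boolP (odd m).
  move: eh; rewrite expnS => /half_eqmod[-> _] //.
apply: IH => //; apply: contra ndv.
rewrite -[X in _ -> _ %| X](odd_double_half m) (negbTE em) add0n -mul2n.
by rewrite expnS dvdn_pmul2l.
Qed.

Lemma letter_mul F z q : letter F z (2 ^ size F * q) = z q.
Proof.
elim: F q => [|a F IH] q /=; first by rewrite expn0 mul1n.
by rewrite expnS -mulnA mul2n odd_double doubleK.
Qed.

Lemma letter_mkseq_mul f j z q : letter (mkseq f j) z (2 ^ j * q) = z q.
Proof. by have := letter_mul (mkseq f j) z q; rewrite size_mkseq. Qed.

Lemma letter_pow F z v a : v < size F ->
  letter F z (2 ^ v * a.*2.+1) = nth false F v (+) odd a.
Proof.
elim: F v => [|b F IH] [|v] //; rewrite /letter -/letter.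
  by rewrite expn0 mul1n /= odd_double uphalf_double.
by rewrite ltnS => lt_v; rewrite expnS -mulnA mul2n odd_double doubleK IH.
Qed.

Lemma letter_cat F F' z m : letter (F ++ F') z m = letter F (letter F' z) m.
Proof. by elim: F m => //= a F IH m; rewrite IH. Qed.

(** Mirroring sends [2 ^ v * a.*2.+1] to [2 ^ v * a'.*2.+1] with [a + a'] odd, because
    [v < size F]. *)
Lemma letter_mirror F z m : 0 < m < 2 ^ size F ->
  letter F z (2 ^ (size F).+1 - m) = ~~ letter F z m.
Proof.
elim: F m => [|a F IH] m /=; first by rewrite expn0; lia.
rewrite expnS => bm.
have -> : odd (2 ^ (size F).+2 - m) = odd m by rewrite !expnS in bm *; lia.
have [om|em] := boolP (odd m).
  rewrite -addbN; congr (_ (+) _); rewrite !expnS in bm *; lia.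
have -> : (2 ^ (size F).+2 - m)./2 = 2 ^ (size F).+1 - m./2.
  by rewrite !expnS in bm *; lia.
by apply: IH; lia.
Qed.

(** * The paperfolding sequence, level by level *)

Definition fold_at (f : nat -> bool) (m : nat) : bool := paperfolding f m.-1.

Definition shift_seq (f : nat -> bool) (j i : nat) : bool := f (j + i).

(** The instruction [f k] fills the hole at [2 ^ k], and the reversed complement after it is
    accounted for by [letter_mirror]. *)
Lemma nth_fold_word f k z m : 0 < m < 2 ^ k ->
  nth false (fold_word f k) m.-1 = letter (mkseq f k) z m.
Proof.
elim: k z m => [|k IH] z m bm; first by rewrite expn0 in bm; lia.
rewrite mkseqS -cats1 letter_cat [fold_word _ _]/= nth_cat size_fold_word.
have sk := size_mkseq f k.
have k0 : 0 < 2 ^ k by rewrite expn_gt0.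
rewrite expnS in bm.
case: (ltngtP m (2 ^ k)) => [lt|gt|->].
- have -> : m.-1 < (2 ^ k).-1 by lia.
  by apply: IH; lia.
- have -> : m.-1 < (2 ^ k).-1 = false by lia.
  have -> : m.-1 - (2 ^ k).-1 = (m - 2 ^ k).-1.+1 by lia.
  rewrite /= (nth_map false) ?size_rev ?size_fold_word; last by lia.
  rewrite nth_rev size_fold_word; last by lia.
  have -> : (2 ^ k).-1 - (m - 2 ^ k).-1.+1 = (2 * 2 ^ k - m).-1 by lia.
  rewrite (IH (letter [:: f k] z)); last by lia.
  rewrite -letter_mirror ?sk; last by lia.
  by congr letter; rewrite expnS; lia.
rewrite -[in RHS](muln1 (2 ^ k)) letter_mkseq_mul.
by rewrite ltnn subnn /= addbF.
Qed.

Lemma fold_at_lt f k z m : 0 < m < 2 ^ k -> fold_at f m = letter (mkseq f k) z m.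
Proof.
move=> bm; rewrite -nth_fold_word // fold_word_prefix nth_mkseq //; lia.
Qed.

Lemma fold_atE f j m : 0 < m ->
  fold_at f m = letter (mkseq f j) (fold_at (shift_seq f j)) m.
Proof.
move=> m0; have lt_m : m < 2 ^ m by rewrite ltn_expl.
have lt2 : m < 2 ^ (j + m).
  by apply: leq_trans lt_m _; rewrite leq_exp2l // leq_addl.
(* At depth [j + m] the position [m] lies before the first hole, so [xpred0] fills nothing that is
   read. *)
rewrite (@fold_at_lt _ (j + m) xpred0) ?m0 //.
have -> : mkseq f (j + m) = mkseq f j ++ mkseq (shift_seq f j) m.
  by rewrite /mkseq iotaD map_cat add0n -{2}[j]addn0 iotaDl -map_comp.
rewrite letter_cat.
have [/dvdnP[q e]|nd] := boolP (2 ^ j %| m); last first.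
  by apply: letter_eqmod; rewrite size_mkseq.
move: m0 lt_m lt2; rewrite {}e => m0 lt_m lt2.
have q0 : 0 < q by case: (q) m0.
rewrite mulnC !letter_mkseq_mul -fold_at_lt // q0 /=.
by rewrite mulnC; apply: leq_ltn_trans lt_m; rewrite leq_pmulr ?expn_gt0.
Qed.

Lemma fold_at_odd f a : fold_at f a.*2.+1 = f 0 (+) odd a.
Proof. by rewrite (@fold_atE _ 1) //= odd_double uphalf_double. Qed.

Lemma fold_at_double f m : 0 < m ->
  fold_at f m.*2 = fold_at (shift_seq f 1) m.
Proof.
by move=> m0; rewrite (@fold_atE _ 1) ?double_gt0 //= odd_double doubleK.
Qed.

(** * Running sums in residue classes *)

Definition golay (f : nat -> bool) : nat -> bool := sum_mod2 (paperfolding f).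

Lemma golayS f s : golay f s.+1 = golay f s (+) fold_at f s.+1.
Proof. by rewrite /golay /sum_mod2 big_ord_recr /= oddD oddb. Qed.

(** Among the first [s.*2] letters, the even positions give the sum for the shifted instructions,
    and the odd ones alternate from [f 0]. *)
Lemma golay_double f s : golay f s.*2 =
  golay (shift_seq f 1) s (+) (f 0 && odd s (+) odd s./2).
Proof.
elim: s => [|s IH]; first by rewrite /golay /sum_mod2 !big_ord0 /= andbF.
rewrite doubleS 2!golayS IH golayS fold_at_odd -doubleS fold_at_double //.
rewrite /= uphalf_half oddD oddb; case: (f 0) (odd s) (odd s./2) => [] [] [];
  by case: (golay _ s); case: fold_at.
Qed.

Lemma golay_count f k s : s < 2 ^ k ->
  golay f s = odd (count (letter (mkseq f k) xpred0) (iota 1 s)).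
Proof.
elim: s => [|s IH] lt_s; first by rewrite /golay /sum_mod2 big_ord0.
have -> : iota 1 s.+1 = iota 1 s ++ [:: s.+1].
  by rewrite -(addn1 s) iotaD add1n addn1.
rewrite golayS IH ?(ltnW lt_s) // count_cat oddD /= addn0 oddb.
by rewrite (@fold_at_lt _ k xpred0).
Qed.

(** Induction on [K] halves [s]. The correction in [golay_double] involves two bits, fixed by a
    residue modulo 4, so the value to reach one level up is known in advance. *)
Lemma golay_onto f K s0 b : 1 < K ->
  exists s, [/\ 0 < s, s = s0 %[mod 2 ^ K] & golay f s = b].
Proof.
elim: K f s0 b => [|[|[|K]] IH] // f s0 b _.
  (* The sums have at most [8 * 5 + 3 < 2 ^ 6] terms, so six instructions decide. *)
  have : has (fun q => golay f (8 * q + s0 %% 4) == b) (iota 1 5).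
    have : s0 %% 4 < 4 by rewrite ltn_mod.
    case: (s0 %% 4) => [|[|[|[|]]]] // _;
      rewrite /= !(@golay_count _ 6) //= /mkseq /=;
      case: (f 0); case: (f 1); case: (f 2); case: (f 3); case: (f 4);
      by case: (f 5); case: b.
  case/hasP => q; rewrite mem_iota => q0 /eqP e.
  exists (8 * q + s0 %% 4); split=> //; first by lia.
  have -> : 8 * q = (q * 2) * 2 ^ 2 by lia.
  by rewrite modnMDl modn_mod.
(* [c] is the correction of [golay_double] at [q.*2], and [d] the extra letter when [s0] is odd. *)
pose c := f 0 && odd s0./2 (+) odd s0./2./2.
pose d := odd s0 && (f 0 (+) odd s0./2).
have [q [q0 eq_q gq]] := IH (shift_seq f 1) s0./2 (b (+) c (+) d) isT.
have [o1 h1] : odd q = odd s0./2 /\ q./2 = s0./2./2 %[mod 2 * 2 ^ K].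
  by move: eq_q; rewrite 2!expnS; apply: half_eqmod.
have [o2 _] := half_eqmod h1.
have g2 : golay f q.*2 = b (+) d.
  by rewrite golay_double gq o1 o2 -/c addbAC addbK.
exists (odd s0 + q.*2); split; first by rewrite addn_gt0 double_gt0 q0 orbT.
  rewrite -[in RHS](odd_double_half s0) -modnDmr -[in RHS]modnDmr.
  by rewrite -!mul2n (expnS 2 K.+2) -!muln_modr eq_q.
rewrite /d in g2; case: (odd s0) g2 => /= g2; last by rewrite g2 addbF.
by rewrite add1n golayS g2 fold_at_odd o1 -addbA addbb addbF.
Qed.

(** No position of the window reaches [2 ^ k], so none is a hole at depth [k], and a start congruent
    to [s] modulo [2 ^ k.+1] sees the same letters. *)
Lemma window_onto f s L b : exists s', [/\ 0 < s', golay f s' = b &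
  forall i, i < L -> fold_at f (s' + i).+1 = fold_at f (s + i).+1].
Proof.
pose k := (s + L).+1.
have lt_k : k < 2 ^ k by rewrite ltn_expl.
have [s' [s'0 es gs]] := @golay_onto f k.+1 s b isT.
exists s'; split=> // i lt_i.
rewrite !(@fold_atE _ k) //; apply/esym/letter_eqmod; rewrite size_mkseq.
  by rewrite -!addnS -modnDml -es modnDml.
apply/negP => /dvdn_leq; rewrite /k in lt_k *; lia.
Qed.

Lemma adjacent_onto f c x y :
  exists q, [/\ 0 < q, odd q = c, fold_at f q = x & fold_at f q.+1 = y].
Proof.
(* Since [q.+1 <= 21 < 2 ^ 5], five instructions determine all letters read. *)
have : has (fun q => [&& odd q == c, fold_at f q == x & fold_at f q.+1 == y])
         (iota 1 20).
  rewrite /= !(@fold_at_lt _ 5 xpred0) //= /mkseq /=.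
  case: (f 0); case: (f 1); case: (f 2); case: (f 3); case: (f 4);
    by case: c; case: x; case: y.
case/hasP => q; rewrite mem_iota => /andP[q0 _] /and3P[/eqP ? /eqP ? /eqP ?].
by exists q.
Qed.

(** * Positions recovered from letters *)

(* Letters at distance 4 agree at odd positions and differ at the positions
   congruent to 2 modulo 4. *)
Lemma letter_parity F z t : 1 < size F ->
  odd t = (letter F z t == letter F z (t + 4)) &&
          (letter F z (t + 2) == letter F z (t + 6)).
Proof.
case: F => [|a [|b F]] //= _.
have -> : odd (t + 4) = odd t by lia.
have -> : odd (t + 2) = odd t by lia.
have -> : odd (t + 6) = odd t by lia.
have -> : (t + 4)./2 = t./2 + 2 by lia.
have -> : (t + 2)./2 = t./2 + 1 by lia.
have -> : (t + 6)./2 = t./2 + 3 by lia.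
have -> : odd (t./2 + 2) = odd t./2 by lia.
have -> : odd (t./2 + 1) = ~~ odd t./2 by lia.
have -> : odd (t./2 + 3) = ~~ odd t./2 by lia.
have -> : (t./2 + 2)./2 = t./2./2 + 1 by lia.
have [//|_] := ifP (odd t); first by rewrite !eqxx.
case: ifP => o /=.
  have -> : odd (t./2./2 + 1) = ~~ odd t./2./2 by lia.
  by case: a b (odd _) => [] [] [].
have -> : (t./2 + 1)./2 = t./2./2 by lia.
have -> : (t./2 + 3)./2 = t./2./2 + 1 by lia.
have -> : odd (t./2./2 + 1) = ~~ odd t./2./2 by lia.
by case: b (odd _); case: eqP => // _; case.
Qed.

(** Halving even positions leads to [letter_parity] one level up, with all distances doubled. *)
Lemma letter_parity2 F z t : 2 < size F -> ~~ odd t ->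
  odd t./2 = (letter F z t == letter F z (t + 8)) &&
             (letter F z (t + 4) == letter F z (t + 12)).
Proof.
case: F => [//|a F] sF et; rewrite (@letter_parity F z) //= !oddD /=.
by rewrite !addbF (negbTE et) !halfD (negbTE et) /= !add0n.
Qed.

Lemma eqmod4_odd a b : odd a = odd b -> a.*2.+1 = b.*2.+1 %[mod 4].
Proof. lia. Qed.

(** The binary digits of the starts agree one at a time: a common residue modulo [2 ^ v.+1] puts odd
    multiples of [2 ^ v] at the same index, and the letter there decides the next digit. *)
Lemma eqmod_extend F z z' m t t' : 0 < size F -> 2 ^ size F <= m ->
  odd t = odd t' ->
  (forall i, i < m -> letter F z (t + i) = letter F z' (t' + i)) ->
  t = t' %[mod 2 ^ (size F).+1].
Proof.
move=> sF le_m ot eq_tt.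
suff: forall v, v <= size F -> t = t' %[mod 2 ^ v.+1] by apply.
elim=> [|v IH] lt_v; first by rewrite !modn2 ot.
have {IH} := IH (ltnW lt_v); rewrite expnS => et.
have H0 : 0 < 2 ^ v by rewrite expn_gt0.
(* Chosen so that [t + i] is [2 ^ v] modulo [2 ^ v.+1]. *)
pose i := (2 ^ v + (2 * 2 ^ v - t %% (2 * 2 ^ v))) %% (2 * 2 ^ v).
have lt_i : i < m.
  apply: leq_trans le_m; apply: leq_trans (_ : 2 ^ v.+1 <= _).
    by rewrite expnS ltn_mod muln_gt0.
  by rewrite leq_exp2l.
have ti : (t + i) %% (2 * 2 ^ v) = 2 ^ v.
  rewrite modnDmr -modnDml.
  have lt_r : t %% (2 * 2 ^ v) < 2 * 2 ^ v by rewrite ltn_mod muln_gt0.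
  by rewrite addnCA subnKC 1?ltnW // modnDr modn_small // ltn_Pmull.
have ti' : (t' + i) %% (2 * 2 ^ v) = 2 ^ v.
  by move: ti; rewrite -modnDml et modnDml.
pose a := (t + i) %/ (2 * 2 ^ v); pose a' := (t' + i) %/ (2 * 2 ^ v).
have ea : t + i = 2 ^ v * a.*2.+1.
  by rewrite {1}(divn_eq (t + i) (2 * 2 ^ v)) ti -/a; clear; lia.
have ea' : t' + i = 2 ^ v * a'.*2.+1.
  by rewrite {1}(divn_eq (t' + i) (2 * 2 ^ v)) ti' -/a'; clear; lia.
have := eq_tt i lt_i; rewrite ea ea' !letter_pow // => /addbI oa.
apply/eqP; rewrite -(eqn_modDr i) ea ea' !expnS.
have -> : 2 * (2 * 2 ^ v) = 2 ^ v * 4 by rewrite mulnA mulnC.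
rewrite -(muln_modr _ a.*2.+1) -(muln_modr _ a'.*2.+1) eqn_pmul2l //.
exact/eqP/eqmod4_odd.
Qed.

(** Seven letters contain the indices 0, 2, 4, 6 of the parity test, which starts the induction of
    [eqmod_extend]. *)
Lemma letter_sync F z z' m t t' : 1 < size F -> 6 < m -> 2 ^ size F <= m ->
  (forall i, i < m -> letter F z (t + i) = letter F z' (t' + i)) ->
  t = t' %[mod 2 ^ (size F).+1].
Proof.
move=> sF m6 le_m eq_tt; apply: (eqmod_extend (ltnW sF) le_m _ eq_tt).
have e0 := eq_tt 0; rewrite !addn0 in e0.
rewrite (@letter_parity F z t) // (@letter_parity F z' t') //.
by rewrite e0 ?eq_tt //; lia.
Qed.

(** Both parity tests read the same under reversal, which makes [t + e] and [T - e] even and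
    congruent modulo 4. Their mirrored neighbours [t + e.+1] and [T - e.+1] are then odd and differ
    by 2 modulo 4, so their letters differ. *)
Lemma fold_at_no_mirror f t T : 13 < T -> 0 < t ->
  ~ (forall i, i < 14 -> fold_at f (t + i) = fold_at f (T - i)).
Proof.
move=> T13 t0 eq_tT.
pose F := mkseq f 3; pose z := fold_at (shift_seq f 3).
have sF : size F = 3 by rewrite size_mkseq.
have {}eq_tT i : i < 14 -> letter F z (t + i) = letter F z (T - i).
  by move=> lt_i; rewrite -!fold_atE ?eq_tT //; lia.
have e0 := eq_tT 0 isT; rewrite addn0 subn0 in e0.
have ot : odd t = odd T.
  have -> : odd T = odd (T - 6) by lia.
  rewrite (@letter_parity F z t) ?sF // (@letter_parity F z (T - 6)) ?sF //.
  rewrite !eq_tT // e0.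
  have -> : T - 6 + 4 = T - 2 by lia.
  have -> : T - 6 + 2 = T - 4 by lia.
  have -> : T - 6 + 6 = T by lia.
  by rewrite andbC; congr andb; apply: eq_sym.
(* The second test starts at the even position [t + e] and reads up to index [e + 12 <= 13]. *)
have [e e1 et] : exists2 e, e <= 1 & ~~ odd (t + e).
  by exists (odd t); lia.
have eT : ~~ odd (T - e - 12).
  have -> : odd (T - e - 12) = odd (T - e) by clear -T13 e1; lia.
  by rewrite oddB -?ot -?oddD //; lia.
have o2 : odd (t + e)./2 = odd (T - e)./2.
  have -> : odd (T - e)./2 = odd (T - e - 12)./2 by lia.
  rewrite (@letter_parity2 F z) ?sF //.
  rewrite (@letter_parity2 F z (T - e - 12)) ?sF //.
  rewrite -!addnA !eq_tT; try by clear -e1; lia.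
  have -> : T - (e + 4) = T - e - 12 + 8 by lia.
  have -> : T - (e + 8) = T - e - 12 + 4 by lia.
  have -> : T - e = T - e - 12 + 12 by lia.
  have -> : T - (e + 12) = T - e - 12 + 12 - 12 by lia.
  by rewrite addnK andbC; congr andb; apply: eq_sym.
have := eq_tT e.+1; rewrite -!fold_atE; try by lia.
have -> : t + e.+1 = (t + e)./2.*2.+1 by lia.
have -> : T - e.+1 = (T - e)./2.-1.*2.+1 by lia.
rewrite !fold_at_odd o2 => H.
have {H} /addbI : f 0 (+) odd (T - e)./2 = f 0 (+) odd (T - e)./2.-1.
  by apply: H; lia.
lia.
Qed.

(** * Coded windows of the paperfolding sequence *)

(* The window of [m] letters which starts [i0 < 2 ^ size F] letters before a
   hole: that hole, with a letter [x], and the next one, with a letter [y], are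
   its only holes if [m <= 2 ^ (size F).+1]. *)
Definition window (F : seq bool) (c x y : bool) (i0 m : nat) : seq bool :=
  mkseq (fun i => if i == i0 then x else if i == i0 + 2 ^ size F then y
                  else letter F xpred0 (2 ^ size F * c.+1 - i0 + i)) m.

Lemma letter_window F z q i0 m : 0 < q -> i0 < 2 ^ size F ->
  m <= 2 ^ (size F).+1 ->
  mkseq (fun i => letter F z (2 ^ size F * q - i0 + i)) m =
  window F (~~ odd q) (z q) (z q.+1) i0 m.
Proof.
move=> q0 lt_i0 le_m; apply/eq_in_map => i; rewrite mem_iota add0n => lt_i.
rewrite expnS in le_m; set H := 2 ^ size F in lt_i0 le_m *.
have H0 : 0 < H by rewrite /H expn_gt0.
have lt_q : i0 < H * q by apply: leq_trans lt_i0 _; rewrite leq_pmulr.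
case: (eqVneq i i0) => [->|ne0].
  by rewrite subnK ?(ltnW lt_q) // letter_mul.
case: (eqVneq i (i0 + H)) => [->|ne1].
  by rewrite addnA subnK ?(ltnW lt_q) // -mulnSr letter_mul.
(* Off the holes only the parity of [q] matters: replacing [q] by 1 or 2 shifts by a multiple of the
   period [2 * H]. *)
have e : H * q - i0 + i = q.-1./2 * (2 * H) + (H * (~~ odd q).+1 - i0 + i).
  have [d ed] : exists d, q = d.*2 + (~~ odd q).+1 by exists q.-1./2; lia.
  have -> : q.-1./2 = d by lia.
  have eH : H * q = d * (2 * H) + H * (~~ odd q).+1.
    by rewrite {1}ed; clear; lia.
  by rewrite eH -addnBA ?addnA // ltnW // (leq_trans lt_i0) // leq_pmulr.
apply: letter_eqmod; first by rewrite -/H expnS -/H e modnMDl.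
rewrite -/H; apply/negP => /dvdnP[k ek].
have {}ek : i + H * q = k * H + i0 by lia.
have : i + H * q = i0 %[mod H] by rewrite ek modnMDl.
rewrite addnC mulnC modnMDl (modn_small lt_i0).
move=> ei; case: (ltnP i H) => leH.
  by rewrite modn_small // in ei; rewrite ei eqxx in ne0.
have lt_iH : i - H < H by lia.
have : (i - H) %% H = i0 by rewrite -ei -[in RHS](subnK leH) modnDr.
by rewrite modn_small // => e0; rewrite -e0 subnK ?eqxx in ne1.
Qed.

(** [i0] is the distance from the start to the first hole; conversely, [adjacent_onto] realizes any
    parity and any two hole letters. *)
Lemma window_foldP f j m w : m <= 2 ^ j.+1 ->
  (exists s, w = mkseq (fun i => fold_at f (s + i).+1) m) <->
  (exists c x y i0, i0 < 2 ^ j /\ w = window (mkseq f j) c x y i0 m).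
Proof.
move=> le_m; have sF := size_mkseq f j.
have H0 : 0 < 2 ^ j by rewrite expn_gt0.
have foldE q i0 : 0 < q -> i0 < 2 ^ j -> i0 < 2 ^ j * q ->
    mkseq (fun i => fold_at f (2 ^ j * q - i0 + i)) m =
    window (mkseq f j) (~~ odd q) (fold_at (shift_seq f j) q)
      (fold_at (shift_seq f j) q.+1) i0 m.
  move=> q0 lt_i0 lt_q; rewrite -letter_window ?sF //.
  by apply: eq_mkseq => i; rewrite -fold_atE // addn_gt0 subn_gt0 lt_q.
split=> [[s ->]|[c [x [y [i0 [lt_i0 ->]]]]]].
  have lt_r : s %% 2 ^ j < 2 ^ j by rewrite ltn_mod.
  have es : 2 ^ j * (s %/ 2 ^ j).+1 - (2 ^ j - (s %% 2 ^ j).+1) = s.+1.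
    rewrite [in RHS](divn_eq s (2 ^ j)) mulnSr mulnC; lia.
  have lt_i0 : 2 ^ j - (s %% 2 ^ j).+1 < 2 ^ j by rewrite ltn_subrL H0.
  set q := (s %/ 2 ^ j).+1 in es.
  exists (~~ odd q), (fold_at (shift_seq f j) q), (fold_at (shift_seq f j) q.+1).
  exists (2 ^ j - (s %% 2 ^ j).+1); split=> //.
  rewrite -foldE //; last by rewrite /q mulnS ltn_addr.
  by apply: eq_mkseq => i; rewrite es addSn.
have [q [q0 oq <- <-]] := adjacent_onto (shift_seq f j) (~~ c) x y.
have lt_q : i0 < 2 ^ j * q by apply: leq_trans lt_i0 _; rewrite leq_pmulr.
exists (2 ^ j * q - i0).-1; rewrite -[c]negbK -oq -foldE //.
by apply: eq_mkseq => i; rewrite -addSn prednK // subn_gt0.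
Qed.

Lemma eqmod_inj_pos a b d : 0 < a <= d -> 0 < b <= d -> a = b %[mod d] -> a = b.
Proof.
case: a b => [//|a] [//|b] /= lt_a lt_b /eqP.
by rewrite -(addn1 a) -(addn1 b) eqn_modDr !modn_small // => /eqP ->.
Qed.

Lemma window_inj F m c x y i0 c' x' y' i0' : 1 < size F -> 6 < m ->
  2 ^ size F <= m <= 2 ^ (size F).+1 -> i0 < 2 ^ size F -> i0' < 2 ^ size F ->
  window F c x y i0 m = window F c' x' y' i0' m ->
  [/\ c = c', i0 = i0', x = x' & i0 + 2 ^ size F < m -> y = y'].
Proof.
move=> sF m6 /andP[le_m ge_m] lt_i0 lt_i0' eq_w.
have H0 : 0 < 2 ^ size F by rewrite expn_gt0.
(* This filling turns a code back into consecutive values of [letter], the form that [letter_sync]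
   compares. *)
have windowE (a : bool) x1 y1 k : k < 2 ^ size F -> window F a x1 y1 k m =
    mkseq (fun i => letter F (fun q => if q == a.+1 then x1 else y1)
                      (2 ^ size F * a.+1 - k + i)) m.
  by move=> lt_k; rewrite letter_window // eqxx gtn_eqF //; case: a.
have eq_t : 2 ^ size F * c.+1 - i0 = 2 ^ size F * c'.+1 - i0'
    %[mod 2 ^ (size F).+1].
  apply: (@letter_sync _ (fun q => if q == c.+1 then x else y)
            (fun q => if q == c'.+1 then x' else y') m) => // i lt_i.
  have := congr1 (fun s => nth false s i) eq_w.
  by rewrite !windowE // !nth_mkseq.
have [ec ei] : c = c' /\ i0 = i0'.
  have bounds (a : bool) k : k < 2 ^ size F ->
      0 < 2 ^ size F * a.+1 - k <= 2 ^ (size F).+1.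
    by rewrite expnS; case: a; clear; lia.
  have := eqmod_inj_pos (bounds c _ lt_i0) (bounds c' _ lt_i0') eq_t.
  by move: lt_i0 lt_i0'; clear; case: c c' => [] []; lia.
rewrite -ec -ei in eq_w *; split=> //.
  have := congr1 (fun s => nth false s i0) eq_w.
  by rewrite !nth_mkseq ?eqxx // (leq_trans lt_i0).
move=> lt_m; have := congr1 (fun s => nth false s (i0 + 2 ^ size F)) eq_w.
by rewrite !nth_mkseq // eqxx gtn_eqF // -[ltnLHS]addn0 ltn_add2l.
Qed.

(** * Factors of the running sums and their number *)

Definition running_sums (b : bool) (w : seq bool) : seq bool :=
  b :: scanl addb b w.

Lemma running_sums_inj b w b' w' :
  running_sums b w = running_sums b' w' -> b = b' /\ w = w'.
Proof.
by case=> <- /(can_inj (scanlK addKb b)).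
Qed.

Lemma mkseqS_cons T (h : nat -> T) n :
  mkseq h n.+1 = h 0 :: mkseq (fun i => h i.+1) n.
Proof. by rewrite /mkseq /= -[1]addn0 iotaDl -map_comp. Qed.

Lemma golay_window f s m : mkseq (fun i => golay f (s + i)) m.+1 =
  running_sums (golay f s) (mkseq (fun i => fold_at f (s + i).+1) m).
Proof.
elim: m s => [|m IH] s; first by rewrite /mkseq /= addn0.
rewrite mkseqS_cons addn0 [in RHS]mkseqS_cons addn0.
under eq_mkseq do rewrite addnS -addSn.
rewrite IH golayS /running_sums /=; congr [:: _, _ & scanl _ _ _].
by apply: eq_mkseq => i; rewrite addnS addSn.
Qed.

Lemma val_factor (g : nat -> bool) n i :
  val [tuple g (i + j) | j < n] = mkseq (fun j => g (i + j)) n.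
Proof. by rewrite /= /mkseq -val_enum_ord -map_comp. Qed.

(** [e] is 0 or 1 according to whether the empty sum is included. *)
Lemma golay_shapiro_shift g : is_generalized_golay_shapiro g ->
  exists f e, e <= 1 /\ forall n, g n = golay f (n + e).
Proof.
case=> f [] gE; [exists f, 0 | exists f, 1]; split=> // n; rewrite gE.
  by rewrite addn0.
by rewrite addn1.
Qed.

(** By [window_onto], the first sum and the window of differences can be prescribed
    independently. *)
Lemma mem_factors g f e m (u : m.+1.-tuple bool) :
  e <= 1 -> (forall n, g n = golay f (n + e)) ->
  reflect (exists b s, val u =
             running_sums b (mkseq (fun i => fold_at f (s + i).+1) m))
          (u \in factors g m.+1).
Proof.
move=> e1 gE; have shiftE i : mkseq (fun j => g (i + j)) m.+1 =
    mkseq (fun j => golay f ((i + e) + j)) m.+1.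
  by apply: eq_mkseq => j; rewrite gE addnAC.
rewrite inE; apply: (iffP (asboolP _)) => [[i ->]|[b [s us]]].
  by exists (golay f (i + e)), (i + e); rewrite val_factor shiftE golay_window.
have [s' [s'0 gs' eq_s]] := window_onto f s m b.
(* [s'] is positive, so [e <= 1] can be subtracted. *)
exists (s' - e); apply: val_inj; rewrite val_factor shiftE subnK; last by lia.
rewrite golay_window gs' us; congr running_sums.
by apply/eq_in_map => i; rewrite mem_iota => /andP[_ lt_i]; rewrite eq_s.
Qed.

Lemma mem_factors_window g : is_generalized_golay_shapiro g ->
  exists f, forall j m (u : m.+1.-tuple bool), m <= 2 ^ j.+1 ->
    u \in factors g m.+1 <->
    exists b c x y i0, i0 < 2 ^ j /\
      val u = running_sums b (window (mkseq f j) c x y i0 m).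
Proof.
case/golay_shapiro_shift=> f [e [e1 gE]]; exists f => j m u le_m; split.
  case/(mem_factors _ e1 gE) => b [s us].
  have /(window_foldP f _ le_m)[c [x [y [i0 [lt_i0 ew]]]]] :
    exists s', mkseq (fun i => fold_at f (s + i).+1) m =
               mkseq (fun i => fold_at f (s' + i).+1) m by exists s.
  by exists b, c, x, y, i0; rewrite us ew.
case=> b [c [x [y [i0 [lt_i0 us]]]]]; apply/(mem_factors _ e1 gE).
have /(window_foldP f _ le_m)[s es] : exists c' x' y' i1, i1 < 2 ^ j /\
  window (mkseq f j) c x y i0 m = window (mkseq f j) c' x' y' i1 m.
  by exists c, x, y, i0.
by exists b, s; rewrite us es.
Qed.

Lemma card_eq_codes n (D : {set n.-tuple bool}) (I : finType)
    (code : I -> seq bool) :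
  (forall i, size (code i) = n) -> injective code ->
  (forall u : n.-tuple bool, u \in D <-> exists i, val u = code i) ->
  #|D| = #|I|.
Proof.
move=> size_code inj_code memD.
have Ps i : size (code i) == n by rewrite size_code.
have -> : D = [set Tuple (Ps i) | i : I].
  apply/setP=> u; apply/idP/imsetP => [/memD[i ui]|[i _ ->]].
    by exists i => //; apply: val_inj.
  by apply/memD; exists i.
by rewrite card_imset ?cardT ?cardE // => i i' [/inj_code].
Qed.

Lemma size_running_sums b w : size (running_sums b w) = (size w).+1.
Proof. by rewrite /= size_scanl. Qed.

(** Let [m = n - 1] and let [H] be the largest power of 2 not above [m]. The bits [b], [c], [x] give
    the factor 8. The pairs of [i0] and [y] number [H + (m - H) = m], as [y] is visible for [m - H]
    values of [i0]. *)
Lemma factor_complexity_golay_shapiro g n :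
  is_generalized_golay_shapiro g -> 7 < n -> factor_complexity g n = 8 * n - 8.
Proof.
case: n => [//|m] /mem_factors_window[f memP] m7; rewrite ltnS in m7.
have m0 : 0 < m by lia.
pose j := trunc_log 2 m; pose F := mkseq f j; pose H := 2 ^ size F.
have sF : size F = j by rewrite size_mkseq.
have /andP[le_m ge_m] : H <= m < 2 ^ (size F).+1.
  by rewrite /H sF; apply: trunc_log_bounds.
have j1 : 1 < size F.
  by rewrite -(@ltn_exp2l 2) // expnS /=; rewrite expnS -/H in ge_m; lia.
have H0 : 0 < H by rewrite expn_gt0.
have le_mH : m <= 2 * H by rewrite -expnS ltnW.
(* The second hole, at the index [i0 + H], is visible only if [i0 + H < m]; the
   index [k] stands for [i0] or [i0 + H] according to the letter in it. *)
pose code (i : bool * bool * bool * 'I_m) :=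
  let: (b, c, x, k) := i in
  running_sums b (window F c x (H <= k) (if H <= k then k - H else k) m).
have -> : 8 * m.+1 - 8 = #|{: bool * bool * bool * 'I_m}|.
  by rewrite !card_prod card_ord card_bool; lia.
have lt_k (k : 'I_m) : (if H <= k then k - H else k) < H.
  by have := ltn_ord k; case: (leqP H k); lia.
apply: (card_eq_codes (code := code)).
- by case=> [[[b c] x] k]; rewrite size_running_sums size_mkseq.
- case=> [[[b c] x] k] [[[b' c'] x'] k'] /running_sums_inj[-> eq_w].
  have bm : 2 ^ size F <= m <= 2 ^ (size F).+1 by rewrite le_m ltnW.
  have [-> eq_i -> eq_y] := window_inj j1 m7 bm (lt_k k) (lt_k k') eq_w.
  congr (_, _); apply: val_inj; move: eq_i eq_y => /=.
  have := ltn_ord k; have := ltn_ord k'; rewrite -/H.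
  case: (leqP H k) => le_k; case: (leqP H k') => le_k' lt_km' lt_km //; first lia.
    move=> e /(_ _) h; have : true = false; last by []. by apply: h; lia.
  move=> e /(_ _) h; have : false = true; last by []. by apply: h; lia.
have eH : 2 ^ j = H by rewrite /H sF.
have le_mj : m <= 2 ^ j.+1 by rewrite -sF ltnW.
move=> u; rewrite (memP j _ _ le_mj) eH -/F; split; last first.
  case=> [[[[b c] x] k]] ->.
  by exists b, c, x, (H <= k), (if H <= k then k - H else k); split.
case=> b [c [x [y [i0 [lt_i0 ->]]]]].
have lt_i0m : i0 < m by apply: leq_trans le_m.
case: (ltnP (i0 + H) m) => [lt_m|ge_m0].
  case: y; last first.
    exists (b, c, x, Ordinal lt_i0m); rewrite /= leqNgt lt_i0 //.
  exists (b, c, x, Ordinal lt_m); by rewrite /= leq_addl addnK.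
(* The second hole is out of sight, so the code with letter [false] there gives the same word. *)
exists (b, c, x, Ordinal lt_i0m); rewrite /= leqNgt lt_i0 /=.
congr running_sums; apply/eq_in_map => i; rewrite mem_iota add0n => lt_i.
by rewrite -/H (ltn_eqF (leq_trans lt_i ge_m0)).
Qed.

(** * Classes under reversal *)

(** [c] is a complete invariant, each class being the fibre of one value. *)
Lemma card_equivalence_partition_refl n (D : {set n.-tuple bool}) (S : eqType)
    (c : seq bool -> S) :
  {in D &, forall u v, refl_equiv u v = (c u == c v)} ->
  #|equivalence_partition (@refl_equiv n) D| =
  size (undup [seq c u | u : n.-tuple bool in D]).
Proof.
move=> cP; set s := undup _.
pose cls t := [set v in D | t == c v].
have cls_inj : {in s &, injective cls}.
  move=> t t'; rewrite mem_undup => /imageP[u uD ->] _ /setP/(_ u).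
  by rewrite !inE uD eqxx /= => /esym/eqP.
have cls_uniq : uniq [seq cls t | t <- s] by rewrite map_inj_in_uniq ?undup_uniq.
rewrite -(size_map cls) -(card_uniqP cls_uniq); apply: eq_card => B.
apply/imsetP/mapP => [[u uD ->]|[t]].
  exists (c u); first by rewrite mem_undup; apply: image_f.
  by apply/setP=> v; rewrite !inE; case vD: (v \in D); rewrite //= cP.
rewrite mem_undup => /imageP[u uD ->] ->; exists u => //.
by apply/setP=> v; rewrite !inE; case vD: (v \in D); rewrite //= cP.
Qed.

Lemma factor_nth (g : nat -> bool) n (u : n.-tuple bool) i l :
  u = [tuple g (i + j) | j < n] -> l < n -> nth false u l = g (i + l).
Proof. by move=> -> lt_l; rewrite [X in nth _ X]val_factor nth_mkseq. Qed.

(** Differences of consecutive letters are paperfolding letters, and reversing a factor reverses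
    them; 15 letters have the 14 differences that [fold_at_no_mirror] takes. *)
Lemma factors_no_mirror g n (u : n.-tuple bool) :
  is_generalized_golay_shapiro g -> 14 < n ->
  u \in factors g n -> [tuple of rev u] \notin factors g n.
Proof.
case/golay_shapiro_shift=> f [e [e1 gE]] n15.
rewrite !inE => /asboolP[i ui]; apply/negP => /asboolP[i' ui'].
have step k : fold_at f (k + e).+1 = g k (+) g k.+1.
  by rewrite !gE addSn golayS addbA addbb.
(* The second position is that of the last difference in the occurrence of the reversed word. *)
apply: (@fold_at_no_mirror f (i + e).+1 (i' + n.-2 + e).+1); first by lia.
  by [].
move=> l lt_l.
have -> : (i + e).+1 + l = ((i + l) + e).+1 by lia.
have -> : (i' + n.-2 + e).+1 - l = (i' + (n.-2 - l) + e).+1 by lia.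
rewrite !step -!addnS -!(factor_nth ui) -?(factor_nth ui'); try lia.
rewrite /= !nth_rev ?size_tuple; try lia.
rewrite addbC; congr (nth _ _ _ (+) nth _ _ _); lia.
Qed.

Lemma refl_complexity_factor_complexity g n :
  is_generalized_golay_shapiro g -> 14 < n ->
  refl_complexity g n = factor_complexity g n.
Proof.
move=> gs n15; rewrite /refl_complexity.
rewrite (@card_equivalence_partition_refl _ _ _ id).
  rewrite undup_id ?size_map -?cardE // map_inj_uniq ?enum_uniq //.
  exact: val_inj.
move=> u v uD vD; rewrite /refl_equiv -!(inj_eq val_inj) eq_sym.
case: eqP => //= _; apply/eqP => ev.
have := factors_no_mirror gs n15 uD.
have -> : [tuple of rev u] = v by apply: val_inj; rewrite /= ev.
by rewrite vD.
Qed.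

(** * Computation for short lengths *)

(** A computable complete invariant of [refl_equiv]. *)
Definition canon (u : seq bool) : seqlexi bool :=
  Order.min (u : seqlexi bool) (rev u : seqlexi bool).

Lemma canon_eq n (u v : n.-tuple bool) : refl_equiv u v = (canon u == canon v).
Proof.
have canon_rev w : canon (rev w) = canon w.
  by rewrite /canon revK Order.TotalTheory.minC.
have canonP w : canon w = w \/ canon w = rev w.
  by rewrite /canon Order.POrderTheory.minEle; case: ifP; [left|right].
rewrite /refl_equiv -!(inj_eq val_inj) /=.
apply/orP/eqP => [[/eqP->|/eqP->]|]; rewrite ?canon_rev //.
case: (canonP u) (canonP v) => -> [] -> e.
- by left; rewrite e.
- by right; rewrite e revK.
- by right; rewrite -e.
by left; rewrite -(inj_eq (can_inj revK)) e.
Qed.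

Definition coded_windows (F : seq bool) (m : nat) : seq (seq bool) :=
  let bits := [:: false; true] in
  [seq window F cx.1 cx.2 yi.1 yi.2 m
  | cx <- [seq (c, x) | c <- bits, x <- bits],
    yi <- [seq (y, i) | y <- bits, i <- iota 0 (2 ^ size F)]].

Definition coded_factors (F : seq bool) (m : nat) : seq (seq bool) :=
  [seq running_sums b w | b <- [:: false; true], w <- coded_windows F m].

Lemma mem_bits (b : bool) : b \in [:: false; true].
Proof. by case: b. Qed.

Lemma mem_coded_factors F m u :
  reflect (exists b c x y i0, i0 < 2 ^ size F /\
             u = running_sums b (window F c x y i0 m))
          (u \in coded_factors F m).
Proof.
apply: (iffP allpairsP) => [[[b w] [_ w_in ->]]|].
  have [[[c x] [y i]] [_ yi_in ew]] := allpairsP w_in.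
  have [[y' i'] [_ i_in [_ ei]]] := allpairsP yi_in.
  exists b, c, x, y, i; split; last by rewrite /= in ew *; rewrite ew.
  by move: i_in; rewrite mem_iota /= ei.
case=> b [c [x [y [i [lt_i ->]]]]]; exists (b, window F c x y i m).
split; rewrite ?mem_bits //; apply/allpairsP; exists ((c, x), (y, i)).
by split=> //; apply: allpairs_f; rewrite ?mem_bits ?mem_iota.
Qed.

(** Codes of short words may coincide; [undup] merges them, and the distinct values of [canon] are
    counted. *)
Lemma refl_complexity_coded g : is_generalized_golay_shapiro g ->
  exists f, forall j m, m <= 2 ^ j.+1 -> refl_complexity g m.+1 =
    size (undup [seq canon u | u <- coded_factors (mkseq f j) m]).
Proof.
case/mem_factors_window => f memP; exists f => j m le_m.
have sF : size (mkseq f j) = j by rewrite size_mkseq.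
rewrite /refl_complexity (card_equivalence_partition_refl (c := canon)).
  2: by move=> u v _ _; exact: canon_eq.
apply/perm_size/perm_undup => w; apply/imageP/mapP => [[u uD ->]|[v vL ->]].
  exists (val u) => //; apply/mem_coded_factors; rewrite sF.
  exact/(memP j).
have size_v : size v == m.+1.
  have [b [c [x [y [i [_ ->]]]]]] := mem_coded_factors _ _ _ vL.
  by rewrite size_running_sums size_mkseq.
exists (Tuple size_v) => //; apply/(memP j) => //=.
by move/mem_coded_factors: vL; rewrite sF.
Qed.

Lemma refl_complexity_small g : is_generalized_golay_shapiro g ->
  [seq refl_complexity g n | n <- iota 1 14] =
    [:: 2; 3; 6; 10; 14; 22; 30; 42; 48; 62; 72; 83; 92; 103].
Proof.
case/refl_complexity_coded => f rE; rewrite (iotaDl 1 0) -map_comp.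
(* [j = 3] admits [m <= 16], hence all [m] below 14. *)
transitivity [seq size (undup [seq canon u | u <- coded_factors (mkseq f 3) m])
             | m <- iota 0 14].
  apply/eq_in_map => m; rewrite mem_iota => /andP[_ lt_m]; apply: rE.
  exact: leq_trans (ltnW lt_m) _.
rewrite /mkseq [map f _]/=.
by case: (f 0) (f 1) (f 2) => [] [] []; vm_compute.
Qed.

Theorem theorem8p5 :
  (forall g : nat -> bool, is_generalized_golay_shapiro g ->
     forall n : nat, 15 <= n ->
       refl_complexity g n = factor_complexity g n /\
       factor_complexity g n = 8 * n - 8) /\
  (forall g h : nat -> bool,
     is_generalized_golay_shapiro g -> is_generalized_golay_shapiro h ->
     forall n : nat, refl_complexity g n = refl_complexity h n) /\
  (forall g : nat -> bool, is_generalized_golay_shapiro g ->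
     [seq refl_complexity g n | n <- iota 1 14] =
       [:: 2; 3; 6; 10; 14; 22; 30; 42; 48; 62; 72; 83; 92; 103]).
Proof.
have large g n : is_generalized_golay_shapiro g -> 15 <= n ->
    refl_complexity g n = factor_complexity g n /\
    factor_complexity g n = 8 * n - 8.
  move=> gs n15; split; first exact: refl_complexity_factor_complexity.
  by apply: factor_complexity_golay_shapiro => //; apply: leq_trans n15.
split; first by move=> g gs n; apply: large.
split; last exact: refl_complexity_small.
move=> g h gs hs n; case: (ltnP 14 n) => [n15|n14].
  by have [-> ->] := large g n gs n15; have [-> ->] := large h n hs n15.
case: n n14 => [_|n n14].
  (* At length 0 the empty word is the only factor of either sequence. *)
  congr #|equivalence_partition _ _|; apply/setP=> u; rewrite !inE.
  by apply/asboolP/asboolP => _; exists 0; rewrite [LHS]tuple0 [RHS]tuple0.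
have := congr1 (fun s => nth 0 s n)
  (etrans (refl_complexity_small gs) (esym (refl_complexity_small hs))).
by rewrite !(nth_map 0) ?size_iota // !nth_iota.
Qed.
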